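(* Let $(X,d,p)$ be a pointed metric space, i.e. a metric space $(X,d)$ with a marked point $p\in X$, and let $S_p(X):=\{d(x,p): x\in X\}\subseteq[0,\infty)$. Then all pretangent spaces to $X$ at $p$ (taken with respect to all normalizing sequences and all corresponding maximal self-stable families) are bounded if and only if the set $S_p(X)$ is $w$-strongly porous at $0$.
   Context: **Pretangent spaces.** Let $(X,d,p)$ be a pointed metric space. A normalizing sequence is a sequence $\tilde r=\{r_n\}_{n\in\mathbb N}$ of positive real numbers tending to $0$. Let $\tilde X$ be the set of all sequences of points of $X$. Two sequences $\tilde x=\{x_n\}_{n\in\mathbb N}$ and $\tilde y=\{y_n\}_{n\in\mathbb N}$ in $\tilde X$ are mutually stable with respect to $\tilde r$ if the finite limit $$\tilde d_{\tilde r}(\tilde x,\tilde y):=\lim_{n\to\infty}\frac{d(x_n,y_n)}{r_n}$$ exists. A family $\tilde F\subseteq\tilde X$ is self-stable (w.r.t. $\tilde r$) if every two $\tilde x,\tilde y\in\tilde F$ are mutually stable. It is maximal self-stable if it is self-stable and for every $\tilde z\in\tilde X$ either $\tilde z\in\tilde F$ or there is $\tilde x\in\tilde F$ such that $\tilde x$ and $\tilde z$ are not mutually stable. Let $\tilde X_{p,\tilde r}$ denote a maximal self-stable family (w.r.t. $\tilde r$) containing the constant sequence $\tilde p=\{p,p,\dots\}$. Then $(\tilde X_{p,\tilde r},\tilde d_{\tilde r})$ is a pseudometric space. A pretangent space to $X$ at $p$ w.r.t. $\tilde r$ is the metric identification $\Omega_{p,\tilde r}^X$ of such a pseudometric space,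 i.e. the quotient of $\tilde X_{p,\tilde r}$ by the relation $\tilde x\sim\tilde y\iff\tilde d_{\tilde r}(\tilde x,\tilde y)=0$, with the metric $\rho(\alpha,\beta)=\tilde d_{\tilde r}(\tilde x,\tilde y)$ for $\tilde x\in\alpha$, $\tilde y\in\beta$. For given $\tilde r$ there may be several families $\tilde X_{p,\tilde r}$, each giving a pretangent space. **Porosity.** Let $\mathbb R^+=[0,\infty)$ and $E\subseteq\mathbb R^+$. A sequence $\{\tau_n\}_{n\in\mathbb N}$ of real numbers is almost decreasing if $\tau_{n+1}\le\tau_n$ for all sufficiently large $n$. Let $\tilde E_0^d$ be the set of almost decreasing sequences $\tilde\tau=\{\tau_n\}_{n\in\mathbb N}$ with $\lim_{n\to\infty}\tau_n=0$ and $\tau_n\in E\setminus\{0\}$ for all $n\in\mathbb N$. Let $\tilde I_E$ be the set of sequences $\{(a_n,b_n)\}_{n\in\mathbb N}$ of open intervals $(a_n,b_n)\subseteq\mathbb R^+$ such that: (1) each $(a_n,b_n)$ is a connected component of $\mathrm{Ext}\,E=\mathrm{Int}(\mathbb R^+\setminus E)$, i.e. $(a_n,b_n)\cap E=\varnothing$, but every open interval $(a,b)\supseteq(a_n,b_n)$ with $(a,b)\ne(a_n,b_n)$ satisfies $(a,b)\cap E\neq\varnothing$; (2) $\lim_{n\to\infty}a_n=0$ and $\lim_{n\to\infty}\frac{b_n-a_n}{b_n}=1$. For sequences $\tilde a=\{a_n\}_{n\in\mathbb N}$ and $\tilde\gamma=\{\gamma_n\}_{n\in\mathbb N}$ of strictly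 positive numbers, write $\tilde a\asymp\tilde\gamma$ if there are constants $c_1,c_2>0$ with $c_1a_n<\gamma_n<c_2a_n$ for all $n\in\mathbb N$. If $0$ is an accumulation point of $E$ and $\tilde\tau\in\tilde E_0^d$, then $E$ is $\tilde\tau$-strongly porous at $0$ if there is a sequence $\{(a_n,b_n)\}_{n\in\mathbb N}\in\tilde I_E$ such that $\tilde\tau\asymp\tilde a$, where $\tilde a=\{a_n\}_{n\in\mathbb N}$. If $0\in E$, then $E$ is $w$-strongly porous at $0$ if for every $\tilde\tau=\{\tau_n\}_{n\in\mathbb N}\in\tilde E_0^d$ there is a subsequence $\tilde\tau'=\{\tau_{n_k}\}_{k\in\mathbb N}\in\tilde E_0^d$ for which $E$ is $\tilde\tau'$-strongly porous at $0$. (If $0$ is an isolated point of $E$, then $\tilde E_0^d=\varnothing$ and $E$ is $w$-strongly porous at $0$.) *)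

(* Defs.v *)
From HB Require Import structures.
From mathcomp Require Import all_boot all_order all_algebra.
From mathcomp Require Import generic_quotient.
From mathcomp Require Import all_classical all_reals all_analysis.

Set Implicit Arguments.
Unset Strict Implicit.
Unset Printing Implicit Defensive.

Import Order.TTheory GRing.Theory Num.Theory.
Import numFieldNormedType.Exports.

Local Open Scope classical_set_scope.
Local Open Scope ring_scope.
Local Open Scope quotient_scope.

Section PretangentSpaces.
Context {R : realType} {X : metricType R}.
Implicit Types (r : nat -> R) (x y z : nat -> X) (F : set (nat -> X)).

Definition normalizing r : Prop :=
  (forall n, 0 < r n) /\ r @ \oo --> (0 : R).

Definition scaled_dist r x y : nat -> R := fun n => mdist (x n) (y n) / r n.

Definition mutually_stable r x y : Prop := cvgn (scaled_dist r x y).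

Definition dtilde r x y : R := limn (scaled_dist r x y).

Definition self_stable r F : Prop :=
  forall x y, F x -> F y -> mutually_stable r x y.

Definition maximal_self_stable r F : Prop :=
  self_stable r F /\
  forall z, F z \/ exists2 x, F x & ~ mutually_stable r x z.

Lemma dtildexx r x : dtilde r x x = 0.
Proof.
rewrite /dtilde (_ : scaled_dist r x x = cst 0) ?lim_cst//.
by apply/funext => n; rewrite /scaled_dist mdistxx mul0r.
Qed.

Lemma dtilde_sym r x y : dtilde r x y = dtilde r y x.
Proof.
rewrite /dtilde (_ : scaled_dist r x y = scaled_dist r y x)//.
by apply/funext => n; rewrite /scaled_dist metric_sym.
Qed.

Lemma dtilde_ge0 r x y : normalizing r -> mutually_stable r x y ->
  0 <= dtilde r x y.
Proof.
move=> [r0 _] xy; apply: limr_ge => //; apply: nearW => n.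
by rewrite divr_ge0 ?mdist_ge0// ltW.
Qed.

Lemma dtilde_triangle r y x z : normalizing r -> mutually_stable r x y ->
  mutually_stable r y z -> mutually_stable r x z ->
  dtilde r x z <= dtilde r x y + dtilde r y z.
Proof.
move=> [r0 _] xy yz xz; rewrite /dtilde -limD//.
apply: ler_lim => //; first exact: is_cvgD.
apply: nearW => n; rewrite /scaled_dist /= -mulrDl.
by rewrite ler_pM2r ?invr_gt0//; exact: metric_triangle.
Qed.

Section MetricIdentification.
Variables (r : nat -> R) (F : set (nat -> X)).
Hypotheses (hr : normalizing r) (hF : maximal_self_stable r F).

Let stable (x y : F) : mutually_stable r (val x) (val y).
Proof. by apply: hF.1; exact: set_valP. Qed.

Arguments stable : clear implicits.

Definition dtilde_eq0 : rel F :=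
  fun x y : F => dtilde r (val x) (val y) == 0.

Let dtilde_eq0_refl : reflexive dtilde_eq0.
Proof. by move=> x; rewrite /dtilde_eq0 dtildexx. Qed.

Let dtilde_eq0_sym : symmetric dtilde_eq0.
Proof. by move=> x y; rewrite /dtilde_eq0 dtilde_sym. Qed.

Let dtilde_eq0_trans : transitive dtilde_eq0.
Proof.
move=> y x z /eqP xy /eqP yz; rewrite /dtilde_eq0 eq_le dtilde_ge0// andbT.
by rewrite (le_trans (dtilde_triangle hr (stable x y) (stable y z) _))// xy yz addr0.
Qed.

Definition dtilde_equiv : equiv_rel F :=
  EquivRel dtilde_eq0 dtilde_eq0_refl dtilde_eq0_sym dtilde_eq0_trans.

Definition pretangent : Type := {eq_quot dtilde_equiv}.

HB.instance Definition _ := Choice.on pretangent.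
HB.instance Definition _ := Quotient.on pretangent.

Definition pretangent_dist (u v : pretangent) : R :=
  dtilde r (val (repr u)) (val (repr v)).

Let dtilde_repr (x : F) : dtilde r (val (repr (\pi_pretangent x))) (val x) = 0.
Proof.
apply/eqP; have : dtilde_equiv (repr (\pi_pretangent x)) x.
  by apply/eqmodP; rewrite reprK.
by [].
Qed.

(* The metric does not depend on the choice of representatives. *)
Lemma pretangent_distE (x y : F) :
  pretangent_dist (\pi_pretangent x) (\pi_pretangent y) = dtilde r (val x) (val y).
Proof.
rewrite /pretangent_dist.
set x' := repr _; set y' := repr _.
have x'x : dtilde r (val x') (val x) = 0 := dtilde_repr x.
have y'y : dtilde r (val y') (val y) = 0 := dtilde_repr y.
apply/eqP; rewrite eq_le; apply/andP; split.
- apply: (le_trans (dtilde_triangle hr (stable x' x) (stable x y') _)) => //.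
  rewrite x'x add0r.
  apply: (le_trans (dtilde_triangle hr (stable x y) (stable y y') _)) => //.
  by rewrite (dtilde_sym r (val y)) y'y addr0.
- apply: (le_trans (dtilde_triangle hr (stable x x') (stable x' y) _)) => //.
  rewrite (dtilde_sym r (val x)) x'x add0r.
  apply: (le_trans (dtilde_triangle hr (stable x' y') (stable y' y) _)) => //.
  by rewrite y'y addr0.
Qed.

Let pretangent_distxx u : pretangent_dist u u = 0.
Proof. exact: dtildexx. Qed.

Let pretangent_dist_positivity u v : pretangent_dist u v = 0 -> u = v.
Proof.
move=> uv; rewrite -[u]reprK -[v]reprK; apply/eqmodP.
by apply/eqP; exact: uv.
Qed.

Let pretangent_dist_sym u v : pretangent_dist u v = pretangent_dist v u.
Proof. exact: dtilde_sym. Qed.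

Let pretangent_dist_triangle v u w :
  pretangent_dist u w <= pretangent_dist u v + pretangent_dist v w.
Proof. by apply: dtilde_triangle => //; exact: stable. Qed.

HB.instance Definition _ := isMetric.Build R pretangent
  pretangent_distxx pretangent_dist_positivity
  pretangent_dist_sym pretangent_dist_triangle.

Lemma pretangent_mdistE (u v : pretangent) : mdist u v = pretangent_dist u v.
Proof. by []. Qed.

End MetricIdentification.

Definition distance_set (p : X) : set R := range (fun x : X => mdist x p).

End PretangentSpaces.

Arguments pretangent {R X r F} hr hF.

Definition bounded_space (R : realType) (M : metricType R) : Prop :=
  exists C : R, forall u v : M, mdist u v <= C.

Section Porosity.
Context {R : realType}.
Implicit Types (E : set R) (tau a b : nat -> R).

Definition almost_decreasing tau : Prop :=
  \forall n \near \oo, tau n.+1 <= tau n.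

Definition E0d E : set (nat -> R) :=
  [set tau | [/\ almost_decreasing tau, tau @ \oo --> (0 : R)
                & forall n, (E `\ 0) (tau n)]].

(* For [E] a set of nonnegative reals: the interval ]s, t[ is nonempty,
   contained in the nonnegative half-line, disjoint from [E], and maximal. *)
Definition ext_component E (s t : R) : Prop :=
  [/\ 0 <= s < t,
      `]s, t[%classic `&` E = set0
    & forall s' t' : R,
        `]s, t[%classic `<=` `]s', t'[%classic ->
        `]s', t'[%classic <> `]s, t[%classic ->
        `]s', t'[%classic `&` E !=set0].

Definition Itilde E : set ((nat -> R) * (nat -> R)) :=
  [set ab | [/\ forall n, ext_component E (ab.1 n) (ab.2 n),
                ab.1 @ \oo --> (0 : R)
              & (fun n => (ab.2 n - ab.1 n) / ab.2 n) @ \oo --> (1 : R)]].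

Definition asymp_seq (alpha gamma : nat -> R) : Prop :=
  exists c1 c2 : R, [/\ 0 < c1, 0 < c2
    & forall n, c1 * alpha n < gamma n < c2 * alpha n].

(* Meant for [E] a set of nonnegative reals and [tau] in [E0d E]; then [0] is
   an accumulation point of [E], and [tau] and [a] are strictly positive. *)
Definition seq_strongly_porous E tau : Prop :=
  exists a b, Itilde E (a, b) /\ asymp_seq tau a.

(* Meant for [E] a set of nonnegative reals containing [0]. *)
Definition w_strongly_porous E : Prop :=
  forall tau, E0d E tau ->
    exists k : nat -> nat, [/\ increasing_seq k, E0d E (tau \o k)
                             & seq_strongly_porous E (tau \o k)].

End Porosity.

(* Main.v *)
(** If [S_p(X)] is w-strongly porous and some [x] in the family has
    [d(x, p) > 0], then along a subsequence [d(x_n, p)] lies just below gaps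
    [(a_n, b_n)] of [S_p(X)] with [a_n] comparable to [r_n] and
    [b_n / r_n --> oo]; the distances to [p] of all the other sequences of the
    family cannot cross these gaps, hence stay bounded after scaling.
    Conversely, if porosity fails at [tau], then for every [j] and all large
    [n] some point lies at distance between [(j + 1) tau_n] and [B_j tau_n]
    from [p].  These points form countably many sequences, which become
    mutually stable along a common subsequence of [tau]; a maximal self-stable
    family containing them is unbounded. *)

Require Import Defs.
From mathcomp Require Import all_boot all_order all_algebra.
From mathcomp Require Import ring lra.
From mathcomp Require Import all_classical all_reals all_analysis.

Set Implicit Arguments.
Unset Strict Implicit.
Unset Printing Implicit Defensive.

Import Order.TTheory GRing.Theory Num.Theory.
Import numFieldNormedType.Exports.

Local Open Scope classical_set_scope.
Local Open Scope ring_scope.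

(** * Extraction of increasing index sequences *)

Lemma increasing_nat_ge_id (k : nat -> nat) n :
  increasing_seq k -> (n <= k n)%N.
Proof.
move=> kincr; elim: n => // n /leq_ltn_trans; apply.
by move/increasing_seqP : kincr; exact.
Qed.

Lemma cvg_increasing_nat (k : nat -> nat) : increasing_seq k -> k @ \oo --> \oo.
Proof.
move=> kincr A [N _ NA]; exists N => // n /= Nn; apply: NA => /=.
exact: leq_trans Nn (increasing_nat_ge_id _ kincr).
Qed.

(** Dependent choice runs on pairs (stage, value), because [Q] depends on the stage as well as on
    two consecutive values; it starts from the value 0. *)
Lemma increasing_seq_choice (Q : nat -> nat -> nat -> Prop) :
  (forall i m, exists n, (m < n)%N /\ Q i m n) ->
  exists k, increasing_seq k /\ forall i, Q i (k i) (k i.+1).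
Proof.
move=> HQ; have [f [f0 fQ]] := @dependent_choice (nat * nat)
  (fun x y => [/\ y.1 = x.1.+1, (x.2 < y.2)%N & Q x.1 x.2 y.2])
  (fun x => cid (let: ex_intro n (conj mn Qn) := HQ x.1 x.2 in
                 ex_intro _ (x.1.+1, n) (And3 erefl mn Qn))) (0, 0).
have fi i : (f i).1 = i.
  by elim: i => [|i IH]; [rewrite f0 | have [-> _ _] := fQ i; rewrite IH].
exists (fun i => (f i).2); split=> [|i]; last by have [_ _] := fQ i; rewrite fi.
by apply/increasing_seqP => i; have [] := fQ i.
Qed.

Lemma increasing_seq_diag (P : nat -> nat -> Prop) :
  (forall i m, exists n, (m < n)%N /\ P i n) ->
  exists k, increasing_seq k /\ forall i, P i (k i).
Proof.
move=> HP.
have [k [/increasing_seqP kincr kP]] :=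
  increasing_seq_choice (Q := fun i _ n => P i n) HP.
(* [k 0] is the starting value of the recursion and need not satisfy [P 0]; the shift drops it. *)
exists (k \o S); split => //; apply/increasing_seqP => n; exact: kincr.
Qed.

Lemma fmap_ultra (T U : Type) (f : T -> U) (F : set_system T) :
  UltraFilter F -> UltraFilter (f @ F).
Proof.
move=> FU; split; first exact: fmap_proper_filter.
move=> G GF FG; apply/seteqP; split => // A GA.
have [//|FC] := in_ultra_setVsetC (f @^-1` A) FU.
have GC : G (~` A) by exact: FG.
by have [x []] := filter_ex (filterI GA GC).
Qed.

(** * Gaps of a subset of the half-line, porosity, simultaneous convergence *)

Section SequencesAndGaps.
Context {R : realType}.
Implicit Types (E : set R) (tau : nat -> R).

Lemma E0d_subseq E tau k : increasing_seq k -> E0d E tau -> E0d E (tau \o k).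
Proof.
move=> kincr [[N _ Ndecr] tau0 tauE]; split.
- exists N => // n /= Nn.
  have : (k n <= k n.+1)%N by rewrite -leEnat kincr.
  have : (N <= k n)%N by exact: leq_trans Nn (increasing_nat_ge_id _ kincr).
  move=> Nk /subnK <-; elim: (_ - _)%N => // i; apply: le_trans.
  by rewrite addSn; apply: Ndecr => /=; exact: leq_trans Nk (leq_addl _ _).
- exact: cvg_comp (cvg_increasing_nat kincr) tau0.
- by move=> n; exact: tauE.
Qed.

(** The supremum of [E] below [u] and the infimum of [E] above [v] bound a component; [e] and [f]
    make them finite. A larger interval passes one of these endpoints, near which [E] has points. *)
Lemma ext_component_gap E (e f u v : R) : 0 <= e -> e <= u -> u < v -> v <= f ->
  E e -> E f -> (forall x, E x -> ~~ (u < x < v)) ->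
  exists a b, [/\ ext_component E a b, e <= a <= u & v <= b].
Proof.
move=> e0 eu uv vf Ee Ef Euv.
pose A := [set x | E x /\ x <= u]; pose B := [set x | E x /\ v <= x].
have supA : has_sup A by split; [exists e | exists u => x []].
have infB : has_inf B by split; [exists f | exists v => x []].
have ea : e <= sup A by exact: sup_upper_bound.
have au : sup A <= u by apply: ge_sup; [exists e | move=> x []].
have vb : v <= inf B by apply: lb_le_inf; [exists f | move=> x []].
have ab : sup A < inf B by rewrite (le_lt_trans au)// (lt_le_trans uv).
exists (sup A), (inf B); split; rewrite ?ea//; split.
- by rewrite ab (le_trans e0).
- rewrite -subset0 => x [/=]; rewrite in_itv/= => /andP[ax xb] Ex.
  have := Euv _ Ex; rewrite negb_and -!leNgt => /orP[xu|vx].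
    have := sup_upper_bound supA (conj Ex xu); rewrite leNgt; exact/negP/negPn.
  have := ge_inf infB.2 (conj Ex vx); rewrite leNgt; exact/negP/negPn.
- move=> s t sub neq.
  (* A larger interval contains the midpoint, so points of [E] close to one endpoint cannot leave it
     on the other side. *)
  have [sm mt] : s < (sup A + inf B) / 2 /\ (sup A + inf B) / 2 < t.
    have /sub : `]sup A, inf B[%classic ((sup A + inf B) / 2).
      by rewrite /= in_itv/=; apply/andP; split; lra.
    by rewrite /= in_itv/= => /andP[].
  have [sa|sa] := ltP s (sup A).
    have sa0 : 0 < sup A - s by rewrite subr_gt0.
    have [x [Ex xu] xs] := sup_adherent sa0 supA.
    have xa : x <= sup A by exact: sup_upper_bound.
    exists x; split => //=; rewrite in_itv/=; apply/andP; split; lra.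
  have [bt|bt] := ltP (inf B) t.
    have bt0 : 0 < t - inf B by rewrite subr_gt0.
    have [x [Ex vx] xt] := inf_adherent bt0 infB.
    have bx : inf B <= x by apply: ge_inf => //; exact: infB.2.
    exists x; split => //=; rewrite in_itv/=; apply/andP; split; lra.
  exfalso; apply: neq; apply/seteqP; split => // x.
  rewrite /= !in_itv/= => /andP[sx xt].
  by rewrite (le_lt_trans sa sx) (lt_le_trans xt bt).
Qed.

Lemma strongly_porous_of_gaps E tau (C : R) : (forall x, E x -> 0 <= x) ->
  E0d E tau ->
  (forall K M : nat, exists n, (M < n)%N /\ exists a b,
     [/\ ext_component E a b, tau n <= a <= C * tau n & K%:R * a < b]) ->
  exists k, [/\ increasing_seq k, E0d E (tau \o k) &
                seq_strongly_porous E (tau \o k)].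
Proof.
move=> E_ge0 Etau gaps.
have tau_gt0 n : 0 < tau n.
  case: Etau => _ _ /(_ n)[/E_ge0 ? /eqP ?].
  by rewrite lt_neqAle eq_sym; apply/andP.
have [k [kincr]] := increasing_seq_diag gaps.
move=> /choice[a] /choice[b] kab.
have Ek := E0d_subseq kincr Etau.
have C0 : 0 < C.
  have [_ /andP[? ?] _] := kab 0; have := tau_gt0 (k 0); nra.
have a_gt0 n : 0 < a n.
  by have [_ /andP[? _] _] := kab n; rewrite (lt_le_trans (tau_gt0 (k n))).
exists k; split => //; exists a, b; split; last first.
  (* The bounds [tau n <= a <= C * tau n] are not strict; these constants make them so. *)
  exists 2^-1, (C + 1); split; [lra | lra | move=> n /=].
  have [_ /andP[? ?] _] := kab n; have := tau_gt0 (k n).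
  by move=> ?; apply/andP; split; nra.
split => /=.
- by move=> n; have [] := kab n.
- have Ctau : (fun n => C * tau (k n)) @ \oo --> 0.
    by rewrite -(mulr0 C); apply: cvgMr; case: Ek.
  apply: (@squeeze_cvgr _ _ _ _ (cst 0) (fun n => C * tau (k n))) => //;
    last exact: cvg_cst.
  apply: nearW => n; have [_ /andP[_ ?] _] := kab n.
  by apply/andP; split => //; rewrite ltW.
- apply/cvgrPdist_lt => e e0.
  have := near_infty_natSinv_lt (PosNum e0); move=> [N _ Ne].
  (* The gap of index [n] satisfies [n * a n < b n], and [1 < e * (N + 1) <= e * n] from [N + 1] on,
     so [a n / b n < e]. *)
  exists N.+1 => // n /= Nn.
  have [[/andP[_ ab] _ _] _ Kab] := kab n.
  have b0 : 0 < b n := lt_trans (a_gt0 n) ab.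
  rewrite (_ : 1 - _ = a n / b n); last by field; rewrite gt_eqF.
  rewrite ger0_norm ?divr_ge0 ?ltW// ltr_pdivrMr//.
  have := Ne N (leqnn _) => /=.
  rewrite -div1r ltr_pdivrMr ?ltr0Sn// => eN.
  rewrite (lt_trans _ (_ : e * (n%:R * a n) < _)) ?ltr_pM2l//.
  rewrite mulrA ltr_pMl// (lt_le_trans eN)// ler_pM2l// ler_nat.
  exact: Nn.
Qed.

(* An ultrafilter finer than [\oo] replaces the diagonal extraction: all the
   [u t] converge along it, and finitely many of them are simultaneously close
   to their limits at arbitrarily large indices. *)
Lemma countable_family_cvg_subseq (T : countType) (u : T -> nat -> R) :
  (forall t, exists B : R, \forall n \near \oo, `|u t n| <= B) ->
  exists k, increasing_seq k /\ forall t, cvgn (u t \o k).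
Proof.
move=> ubnd.
have [U [UU ooU]] := ultraFilterLemma eventually_filter.
have /choice[l ul] t : exists l : R, u t @ U --> l.
  have [B uB] := ubnd t.
  have UB : (u t @ U) `[- B, B]%classic.
    by apply: ooU; apply: filterS uB => n /=; rewrite in_itv/= -ler_norml.
  have := @segment_compact R (- B) B; rewrite compact_ultra.
  by move=> /(_ (u t @ U) (fmap_ultra _ UU) UB)[l [_ ?]]; exists l.
have [k [kincr kP]] : exists k, increasing_seq k /\
    forall i, forall t, (pickle t < i)%N -> `|l t - u t (k i)| < i.+1%:R^-1.
  apply: (@increasing_seq_diag (fun i n => forall t, (pickle t < i)%N ->
      `|l t - u t n| < i.+1%:R^-1)) => i m.
  (* Only finitely many conditions can be intersected in a filter: the [t] with code below [i] are
     reached through the ordinals [j : 'I_i]. *)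
  have UP : U [set n | forall j : 'I_i, forall t, unpickle j = Some t ->
      `|l t - u t n| < i.+1%:R^-1].
    apply: filter_forall => j; case: unpickle => [t|]; last first.
      exact: filterS filterT.
    have /cvgrPdist_lt/(_ i.+1%:R^-1) := ul t.
    rewrite invr_gt0 ltr0Sn => /(_ isT); apply: filterS => n ? _ [<-] //.
  have Um : U [set n | (m < n)%N] by apply: ooU; exact: nbhs_infty_gt.
  have [n [nP mn]] := filter_ex (filterI UP Um).
  exists n; split => // t ti.
  by apply: (nP (Ordinal ti)); rewrite pickleK.
exists k; split => // t; apply: (cvgP (l t)); apply/cvgrPdist_lt => e e0.
have [N _ Ne] := near_infty_natSinv_lt (PosNum e0).
exists (maxn N (pickle t).+1) => // n /=; rewrite geq_max => /andP[Nn tn].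
exact: lt_trans (kP _ _ tn) (Ne _ Nn).
Qed.

End SequencesAndGaps.

(** * Self-stable families and the two implications *)

Section Pretangent.
Context {R : realType} {X : metricType R}.
Implicit Types (r : nat -> R) (F : set (nat -> X)).

Lemma mutually_stable_sym r (x y : nat -> X) :
  mutually_stable r x y -> mutually_stable r y x.
Proof.
rewrite /mutually_stable (_ : scaled_dist r y x = scaled_dist r x y)//.
by apply/funext => n; rewrite /scaled_dist metric_sym.
Qed.

Lemma mutually_stable_refl r (x : nat -> X) : mutually_stable r x x.
Proof.
rewrite /mutually_stable (_ : scaled_dist r x x = cst 0);
  first exact: is_cvg_cst.
by apply/funext => n; rewrite /scaled_dist mdistxx mul0r.
Qed.

Lemma self_stable_extend r F0 : self_stable r F0 ->
  exists F, F0 `<=` F /\ maximal_self_stable r F.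
Proof.
move=> F0s.
(* Zorn on the [G] with [F0 `|` G] self-stable also covers the empty chain. *)
have [|G [Gs Gmax]] :=
    @Zorn_bigcup (nat -> X) (fun G => self_stable r (F0 `|` G)).
  move=> C Cs Ctot x y [F0x|[G CG Gx]] [F0y|[H CH Hy]].
  - exact: F0s.
  - by apply: (Cs H CH); [left|right].
  - by apply: (Cs G CG); [right|left].
  - have [GH|HG] := Ctot _ _ CG CH.
      by apply: (Cs H CH); right => //; exact: GH.
    by apply: (Cs G CG); right => //; exact: HG.
exists (F0 `|` G); split; [by left | split => // z].
have [Fz|nFz] := pselect ((F0 `|` G) z); [by left | right].
apply: contrapT => zs.
have {}zs x : (F0 `|` G) x -> mutually_stable r x z.
  by move=> Fx; apply: contrapT => xz; apply: zs; exists x.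
apply: (Gmax (G `|` [set z])).
  by split; [left | move=> /(_ z (or_intror erefl)) Gz; apply: nFz; right].
have FG x : (F0 `|` (G `|` [set z])) x -> (F0 `|` G) x \/ x = z.
  by move=> [?|[?|->]]; [left; left | left; right | right].
move=> x y /FG[Fx|->] /FG[Fy|->].
- exact: Gs.
- exact: zs.
- by apply: mutually_stable_sym; exact: zs.
- exact: mutually_stable_refl.
Qed.

(** The triangle inequality through [p] reduces boundedness to distances from one base point, which
    takes the quotient out of the remaining argument. *)
Lemma bounded_pretangentP r F (hr : normalizing r)
    (hF : maximal_self_stable r F) (p : nat -> X) : F p ->
  bounded_space (pretangent hr hF) <->
  exists C, forall x, F x -> dtilde r x p <= C.
Proof.
move=> Fp; split=> [[C Cb]|[C Cb]].
  exists C => x Fx.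
  have := pretangent_distE hr hF (SigSub (mem_set Fx)) (SigSub (mem_set Fp)).
  by move=> <-; exact: Cb.
exists (C + C) => u v; rewrite pretangent_mdistE /pretangent_dist.
have Fu := set_valP (repr u); have Fv := set_valP (repr v).
have [Fs _] := hF.
apply: (le_trans (dtilde_triangle (y := p) hr _ _ _)); try exact: Fs.
by rewrite lerD ?(dtilde_sym r p)//; exact: Cb.
Qed.

Lemma distance_set_ge0 (p : X) s : distance_set p s -> 0 <= s.
Proof. by move=> [x _ <-]; exact: mdist_ge0. Qed.

Lemma cvg_scaled_dist r F (x y : nat -> X) : maximal_self_stable r F ->
  F x -> F y -> scaled_dist r x y @ \oo --> dtilde r x y.
Proof. by move=> [Fs _] Fx Fy; exact: Fs. Qed.

Lemma cvg_dist0 r (x y : nat -> X) (c : R) : normalizing r ->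
  scaled_dist r x y @ \oo --> c ->
  (fun n => mdist (x n) (y n)) @ \oo --> (0 : R).
Proof.
move=> [r_gt0 r0] xyc; rewrite -(mulr0 c).
rewrite (_ : (fun n => _) = scaled_dist r x y \* r); first exact: cvgM.
by apply/funext => n; rewrite /scaled_dist /= divfK// gt_eqF.
Qed.

Lemma dtilde_le_of_porous r F (p : X) : normalizing r ->
  maximal_self_stable r F -> F (fun _ => p) ->
  w_strongly_porous (distance_set p) ->
  exists C, forall x, F x -> dtilde r x (fun _ => p) <= C.
Proof.
move=> hr hF Fp porous; have [r_gt0 r0] := hr.
(* Either every sequence is at distance 0 from the base point, or some [x] at distance [c > 0]
   serves as a yardstick for the others. *)
have [|] := pselect (forall x, F x -> dtilde r x (fun _ => p) <= 0).
  by exists 0.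
move=> /existsNP[x /not_implyP[Fx /negP]]; rewrite -ltNge.
have := cvg_scaled_dist hF Fx Fp; set c := dtilde r x _ => xc c_gt0.
have x0 := cvg_dist0 hr xc; pose t n := mdist (x n) p.
have [h [hincr hP]] : exists h, increasing_seq h /\
    forall i, 0 < t (h i) /\ t (h i.+1) <= t (h i).
  (* The premise [0 < t m] is there for the starting index, where [t] may vanish; that index is
     dropped below. *)
  have step (i m : nat) : exists n,
      (m < n)%N /\ (0 < t n /\ (0 < t m -> t n <= t m)).
    have t_gt0 : \forall n \near \oo, 0 < t n.
      apply: filterS (cvgr_gt _ xc _ c_gt0) => n.
      by rewrite /scaled_dist pmulr_lgt0 ?invr_gt0.
    have tm : \forall n \near \oo, 0 < t m -> t n <= t m.
      have [tm|tm] := ltP 0 (t m); last by apply: nearW.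
      by apply: filterS (cvgr_lt _ x0 _ tm) => n /ltW.
    have [n [mn [? ?]]] :=
      filter_ex (filterI (nbhs_infty_gt m) (filterI t_gt0 tm)).
    by exists n.
  have [h [/increasing_seqP hincr hP]] := increasing_seq_choice step.
  exists (h \o S); split; first by apply/increasing_seqP=> i; exact: hincr.
  by move=> i /=; have [? _] := hP i; split => //; apply: (hP i.+1).2.
have hE : E0d (distance_set p) (t \o h).
  split.
  - by apply: nearW => n; exact: (hP n).2.
  - exact: cvg_comp (cvg_increasing_nat hincr) x0.
  - move=> n; split; first by exists (x (h n)).
    by apply/eqP; rewrite gt_eqF// (hP n).1.
have [k [kincr _ [a [b [[ab _ b1] [c1 [c2 [c1_gt0 c2_gt0 asymp]]]]]]]] :=
  porous _ hE.
pose s := h \o k.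
have soo : s @ \oo --> \oo.
  exact: cvg_comp (cvg_increasing_nat kincr) (cvg_increasing_nat hincr).
(* If [d > c2 * c], the limit ratio [d / c] exceeds [c2], which eventually puts [y] beyond the left
   endpoints [a n < c2 * t (s n)]; being finite, it also keeps [y] below some [b n], hence inside a
   gap. *)
exists (c2 * c) => y Fy; rewrite leNgt; apply/negP.
have := cvg_scaled_dist hF Fy Fp; set d := dtilde r y _ => yd cd.
have d_gt0 : 0 < d by rewrite (lt_trans _ cd)// mulr_gt0.
have yx : (fun n => mdist (y n) p / t n) @ \oo --> d / c.
  apply: (@cvg_trans _ ((fun n => scaled_dist r y (fun _ => p) n /
      scaled_dist r x (fun _ => p) n) @ \oo)); last first.
    by apply: cvgM => //; apply: cvgV => //; rewrite gt_eqF.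
  apply: near_eq_cvg; apply: nearW => n /=.
  by rewrite /scaled_dist invfM invrK mulrACA mulVf ?mulr1// gt_eqF.
have {}yx : (fun n => mdist (y (s n)) p / t (s n)) @ \oo --> d / c.
  exact: cvg_comp soo yx.
have e1 : c2 < d / c by rewrite ltr_pdivlMr.
have e2 : d / c < 2 * (d / c) by rewrite ltr_pMl ?divr_gt0// ltr1n.
(* With [D = 2 * (d / c)], this threshold on [(b n - a n) / b n] gives [D * a n < c1 * b n]; as
   [c1 * t (s n) < a n], it follows that [D * t (s n) < b n]. *)
have e3 : 1 - c1 / (2 * (d / c)) < 1.
  by rewrite ltrBlDr ltrDl !divr_gt0// mulr_gt0// divr_gt0.
have [n [[yl yu] bn]] := filter_ex (filterI (filterI (cvgr_gt _ yx _ e1)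
  (cvgr_lt _ yx _ e2)) (cvgr_gt _ b1 _ e3)).
have [/andP[a_ge0 ltab] abE _] := ab n.
have := asymp n; rewrite /= => /andP[ta at_].
have tn : 0 < t (s n) by have [] := hP (k n).
have b_gt0 : 0 < b n by exact: le_lt_trans ltab.
move: yl yu bn; rewrite /= ltr_pdivlMr// ltr_pdivrMr// ltr_pdivlMr//.
move=> yl yu bn.
suff : (`]a n, b n[%classic `&` distance_set p) (mdist (y (s n)) p).
  by rewrite abE.
split; last by exists (y (s n)).
rewrite /= in_itv/= (lt_trans at_ yl)/= (lt_trans yu)//.
have D_gt0 : 0 < 2 * (d / c) by rewrite mulr_gt0// divr_gt0.
have : a n < c1 / (2 * (d / c)) * b n by lra.
rewrite mulrAC ltr_pdivlMr// => aD.
by rewrite -(ltr_pM2l c1_gt0) (lt_trans _ aD)// mulrCA [ltRHS]mulrC ltr_pM2l.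
Qed.

(** Bounds on the distances to [p] bound all mutual distances by the triangle inequality, so the
    extraction can be applied to the countable family of pairs. *)
Lemma scaled_dist_subseq_family r (T : countType) (y : T -> nat -> X) (p : X) :
  (forall n, 0 < r n) ->
  (forall t, exists B : R, \forall n \near \oo,
    scaled_dist r (y t) (fun _ => p) n <= B) ->
  exists k, increasing_seq k /\ forall t t',
    mutually_stable (r \o k) (y t \o k) (y t' \o k).
Proof.
move=> r_gt0 ybnd.
have [|k [kincr kc]] := @countable_family_cvg_subseq R (T * T)%type
  (fun tt' => scaled_dist r (y tt'.1) (y tt'.2)).
  move=> [t t'] /=; have [B tB] := ybnd t; have [B' tB'] := ybnd t'.
  exists (B + B'); apply: filterS2 tB tB' => n tB tB'.
  rewrite ger0_norm ?divr_ge0 ?mdist_ge0 ?(ltW (r_gt0 _))//.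
  rewrite (le_trans _ (lerD tB tB'))// -mulrDl ler_pM2r ?invr_gt0//.
  by rewrite (metric_sym (y t' n)); exact: metric_triangle.
by exists k; split => // t t'; exact: (kc (t, t')).
Qed.

Lemma unbounded_of_not_porous (p : X) : ~ w_strongly_porous (distance_set p) ->
  exists r F, [/\ normalizing r, maximal_self_stable r F, F (fun _ => p) &
    forall C, exists2 x, F x & C < dtilde r x (fun _ => p)].
Proof.
move=> /existsNP[tau /not_implyP[Etau nporous]].
have [_ tau0 tauE] := Etau.
have tau_gt0 n : 0 < tau n.
  have [/distance_set_ge0 ? /eqP ?] := tauE n.
  by rewrite lt_neqAle eq_sym; apply/andP.
have far (j : nat) : exists (xB : (nat -> X) * R), \forall n \near \oo,
    j.+1%:R < scaled_dist tau xB.1 (fun _ => p) n < xB.2.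
  have /existsNP[K /existsNP[M noGap]] : ~ forall K M : nat,
      exists n, (M < n)%N /\ exists a b,
        [/\ ext_component (distance_set p) a b, tau n <= a <= j.+1%:R * tau n
          & K%:R * a < b].
    move=> gaps; apply: nporous.
    by have := strongly_porous_of_gaps (@distance_set_ge0 p) Etau gaps.
  (* An empty interval from [C * tau n] to [B * tau n] lies in a component with [a <= C * tau n] and
     [b >= B * tau n > K * a]. Taking [K + 2] also ensures [C < B] when [K = 0]. *)
  set C : R := j.+1%:R; set B : R := K.+2%:R * C.
  have C_ge1 : 1 <= C by rewrite ler1n.
  have C_gt0 : 0 < C by rewrite ltr0n.
  have CB : C < B by rewrite ltr_pMl// ltr1n.
  have near_gap : \forall n \near \oo, exists x, C < mdist x p / tau n < B.
    (* [tau 0] will be the point of the distance set above the gap, and [tau n] the one below. *)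
    have Bt : \forall n \near \oo, B * tau n < tau 0%N.
      apply: (cvgr_lt 0) => //; rewrite -(mulr0 B); exact: cvgMr.
    apply: filterS2 (nbhs_infty_gt M) Bt => n Mn Bn.
    apply: contrapT => nox; apply: noGap; exists n; split => //.
    have tn := tau_gt0 n.
    have tC : tau n <= C * tau n by rewrite ler_pMl.
    have CtB : C * tau n < B * tau n by rewrite ltr_pM2r.
    have gap s : distance_set p s -> ~~ (C * tau n < s < B * tau n).
      move=> [x _ xs]; apply/negP => Bs; apply: nox; exists x.
      by rewrite xs ltr_pdivlMr// ltr_pdivrMr.
    have [a [b [ab ea vb]]] := ext_component_gap (ltW tn) tC CtB (ltW Bn)
      (tauE n).1 (tauE 0%N).1 gap.
    exists a, b; split => //; apply: lt_le_trans vb.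
    have /andP[_ aC] := ea.
    rewrite (@le_lt_trans _ _ (K%:R * (C * tau n))) ?ler_wpM2l//.
    by rewrite -mulrA ltr_pM2r ?ltr_nat ?mulr_gt0.
  (* The finitely many early indices may offer no such point; there [p] is a default value. *)
  have /choice[x xP] : forall n, exists z,
      (exists x, C < mdist x p / tau n < B) ->
      C < mdist z p / tau n < B.
    move=> n; have [[z ?]|?] := pselect (exists x, C < mdist x p / tau n < B).
      by exists z.
    by exists p.
  by exists (x, B); apply: filterS near_gap => n /xP.
have /choice[xB far_xB] := far.
(* [None] puts the constant sequence [p] into the family. *)
pose y (o : option nat) : nat -> X :=
  if o is Some j then (xB j).1 else fun _ => p.
have [|k [kincr yk]] := scaled_dist_subseq_family (y := y) (p := p) tau_gt0.
  move=> [j|]; last first.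
    by exists 0; apply: nearW => n; rewrite /scaled_dist /= mdistxx mul0r.
  by exists (xB j).2; apply: filterS (far_xB j) => n /andP[_ /ltW].
have [|F [yF hF]] := @self_stable_extend (tau \o k) (range (fun o => y o \o k)).
  by move=> _ _ [i _ <-] [j _ <-]; exact: yk.
exists (tau \o k), F.
have Fp : F (fun _ => p) by apply: yF; exists None.
split => //.
  split=> [n|]; first exact: tau_gt0.
  exact: cvg_comp (cvg_increasing_nat kincr) tau0.
(* This [j] has [C < j + 1], and the [j]-th sequence stays at scaled distance at least [j + 1] from
   [p]. *)
move=> C; pose j := Num.trunc C.
have Fj : F (y (Some j) \o k) by apply: yF; exists (Some j).
exists (y (Some j) \o k) => //.
apply: (@lt_le_trans _ _ j.+1%:R); first exact: truncnS_gt.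
apply: limr_ge; first exact: hF.1.
have far_k : \forall n \near \oo,
    j.+1%:R < scaled_dist tau (xB j).1 (fun _ => p) (k n) < (xB j).2.
  exact: cvg_increasing_nat kincr _ (far_xB j).
apply: filterS far_k => n.
by move=> /andP[/ltW].
Qed.

End Pretangent.

Theorem theorem2p5 (R : realType) (X : metricType R) (p : X) :
  (forall (r : nat -> R) (F : set (nat -> X))
          (hr : normalizing r) (hF : maximal_self_stable r F),
      F (fun _ => p) -> bounded_space (pretangent hr hF))
  <-> w_strongly_porous (distance_set p).
Proof.
split=> [bounded|porous r F hr hF Fp]; last first.
  by apply/(bounded_pretangentP hr hF Fp); exact: dtilde_le_of_porous porous.
apply: contrapT => /unbounded_of_not_porous[r [F [hr hF Fp unbounded]]].
have /(bounded_pretangentP hr hF Fp)[C CF] := bounded _ _ hr hF Fp.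
by have [x /CF] := unbounded C; rewrite leNgt => /negP.
Qed.
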